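(* The negative eigenvalues of $\mathcal A_2$ lie in the interval $$I_-=\Big[\tfrac12\Big(\psi_{min}-\nu_{max}-\sqrt{(\psi_{min}+\nu_{max})^2+4\sigma_{max}^2}\Big),\ \min\{\beta_1,\max\{\beta_2,\beta_3\}\}\Big],$$ where $$\beta_1=\tfrac12\Big(\psi_{max}-\nu_{min}-\sqrt{(\psi_{max}+\nu_{min})^2+4\sigma_{min}^2}\Big),\quad \beta_2=-\rho_{max}^{-1}\theta_{min}^2,\quad \beta_3=\tfrac12\Big(\psi_{max}-\sqrt{\psi_{max}^2+4\theta_{min}^2}\Big),$$ and the positive eigenvalues of $\mathcal A_2$ lie in the interval $$I_+=\Big[\tfrac12\Big(\psi_{min}-\nu_{max}+\sqrt{(\psi_{min}+\nu_{max})^2+4\sigma_{min}^2}\Big),\ \tfrac12\Big(\psi_{max}-\nu_{min}+\sqrt{(\psi_{max}+\nu_{min})^2+4\sigma_{max}^2}\Big)\Big].$$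
   Context: Let $N,n\ge 1$ be integers, $m=(N+1)n$, $p_0,\dots,p_N\ge 0$ integers with $p=\sum_{i=0}^N p_i\ge 1$. Let $B,Q_1,\dots,Q_N\in\mathbb R^{n\times n}$ and $R_i\in\mathbb R^{p_i\times p_i}$ ($0\le i\le N$) be symmetric positive definite, and let $M_0,\dots,M_{N-1}\in\mathbb R^{n\times n}$, $H_i\in\mathbb R^{p_i\times n}$ ($0\le i\le N$) be arbitrary. Define the block diagonal matrices $\mathbf D=\mathrm{diag}(B,Q_1,\dots,Q_N)\in\mathbb R^{m\times m}$, $\mathbf R=\mathrm{diag}(R_0,\dots,R_N)\in\mathbb R^{p\times p}$, $\mathbf H=\mathrm{diag}(H_0,\dots,H_N)\in\mathbb R^{p\times m}$, and let $\mathbf L\in\mathbb R^{m\times m}$ be the block lower bidiagonal matrix with $n\times n$ identity blocks on the diagonal and blocks $-M_0,\dots,-M_{N-1}$ on the first block subdiagonal (all other blocks zero). Define $$\mathcal A_2=\begin{pmatrix}\mathbf D&\mathbf L\\ \mathbf L^T&-\mathbf H^T\mathbf R^{-1}\mathbf H\end{pmatrix}\in\mathbb R^{2m\times 2m}.$$ Notation: $\psi_{min},\psi_{max}$ are the smallest and largest eigenvalues of $\mathbf D$; $\nu_{min},\nu_{max}$ those of $\mathbf H^T\mathbf R^{-1}\mathbf H$; $\rho_{max}$ is the largest eigenvalue of $\mathbf R$; $\sigma_{min},\sigma_{max}$ are the smallest and largest singular values of $\mathbf L$; $\theta_{min}$ is the smallest nonzero singular value of $(\mathbf L^T\ \ \mathbf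 H^T)\in\mathbb R^{m\times(m+p)}$. *)

(* Defs.v *)
From mathcomp Require Import all_boot all_order all_algebra.
From mathcomp Require Import reals.

Set Implicit Arguments.
Unset Strict Implicit.
Unset Printing Implicit Defensive.

Import Order.TTheory GRing.Theory Num.Theory.
Local Open Scope ring_scope.

Definition sym_posdef (R : realType) (n : nat) (A : 'M[R]_n) : Prop :=
  A^T = A /\ forall x : 'cV[R]_n, x != 0 -> 0 < (x^T *m A *m x) 0 0.

(* The Gram matrix is taken on the smaller side, so that an r x c matrix has
   exactly minn r c singular values (with multiplicity): no spurious zero
   appears for rectangular matrices. *)
Definition singular_value (R : realType) (r c : nat) (A : 'M[R]_(r, c))
    (s : R) : bool :=
  (0 <= s) && (if (r <= c)%N then eigenvalue (A *m A^T) (s ^+ 2)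
               else eigenvalue (A^T *m A) (s ^+ 2)).

Definition is_smallest (R : realType) (P : pred R) (a : R) : Prop :=
  P a /\ forall b : R, P b -> a <= b.

Definition is_largest (R : realType) (P : pred R) (a : R) : Prop :=
  P a /\ forall b : R, P b -> b <= a.

(* Q is indexed from 0: Q k stands for Q_{k+1}. *)
Definition blockD (R : realType) (N n : nat) (B : 'M[R]_n)
    (Q : 'I_N -> 'M[R]_n) : 'M[R]_(\sum_(i < N.+1) n) :=
  \mxdiag_(i < N.+1) (if unlift ord0 i is Some k then Q k else B).

Definition blockR (R : realType) (N : nat) (p : 'I_N.+1 -> nat)
    (R_ : forall i : 'I_N.+1, 'M[R]_(p i)) : 'M[R]_(\sum_(i < N.+1) p i) :=
  \mxdiag_(i < N.+1) R_ i.

Definition blockH (R : realType) (N n : nat) (p : 'I_N.+1 -> nat)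
    (H_ : forall i : 'I_N.+1, 'M[R]_(p i, n)) :
    'M[R]_(\sum_(i < N.+1) p i, \sum_(i < N.+1) n) :=
  \mxblock_(i < N.+1, j < N.+1) (if i == j then H_ i else 0).

(* The block in position (k+1, k) is - M k. *)
Definition blockL (R : realType) (N n : nat) (M : 'I_N -> 'M[R]_n) :
    'M[R]_(\sum_(i < N.+1) n) :=
  \mxblock_(i < N.+1, j < N.+1)
    (if i == j then 1%:M
     else if unlift ord0 i is Some k then
       (if k == j :> nat then - M k else 0)
     else 0).

Definition saddle2 (R : realType) (m p : nat) (bD bL : 'M[R]_m)
    (bR : 'M[R]_p) (bH : 'M[R]_(p, m)) : 'M[R]_(m + m) :=
  block_mx bD bL bL^T (- (bH^T *m invmx bR *m bH)).

(* Main.v *)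
(* An eigenpair l, (x, y) of A2 satisfies D x + L y = l x and
   L^T x - S y = l y with S = H^T R^-1 H.  For l > 0, pairing the first equation
   with x and substituting L^T x = (S + l) y squeezes x^T L y between
   |L^T x|^2 / (nu_max + l) and |L^T x|^2 / (nu_min + l) by Cauchy-Schwarz, and
   Rayleigh quotient bounds turn this into two quadratic inequalities for l.
   Exchanging the roles of x and y, - A2 has the same shape with D and S
   swapped, which handles l < 0 except for beta2 and beta3.  For these,
   y^T S y >= |H y|^2 / rho_max and
   x^T (D - l) x >= |L y|^2 / (psi_max - l) give
   - l |y|^2 >= min (1 / rho_max) (1 / (psi_max - l)) (|L y|^2 + |H y|^2),
   and the last factor is at least theta_min^2 |y|^2 because L is invertible,
   so that no singular value of (L^T H^T) vanishes. *)
Require Import Defs.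
From mathcomp Require Import all_boot all_order all_algebra.
From mathcomp Require Import reals complex ring lra.

Set Implicit Arguments.
Unset Strict Implicit.
Unset Printing Implicit Defensive.

Import Order.TTheory GRing.Theory Num.Theory.
Local Open Scope ring_scope.

(** * Euclidean inner product and Cauchy-Schwarz for semidefinite forms *)

Definition dotc (R : pzRingType) (n : nat) (u v : 'cV[R]_n) : R :=
  (u^T *m v) 0 0.

Section Dot.
Variables (R : realFieldType) (n : nat).
Implicit Types (u v w : 'cV[R]_n) (A : 'M[R]_n).

Lemma dotcC u v : dotc u v = dotc v u.
Proof. by rewrite /dotc -[v in LHS]trmxK -trmx_mul mxE. Qed.

Lemma dotcDr u v w : dotc u (v + w) = dotc u v + dotc u w.
Proof. by rewrite /dotc mulmxDr mxE. Qed.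

Lemma dotcZr a u v : dotc u (a *: v) = a * dotc u v.
Proof. by rewrite /dotc -scalemxAr mxE. Qed.

Lemma dotcBr u v w : dotc u (v - w) = dotc u v - dotc u w.
Proof. by rewrite -scaleN1r dotcDr dotcZr mulN1r. Qed.

Lemma dotcDl u v w : dotc (u + v) w = dotc u w + dotc v w.
Proof. by rewrite dotcC dotcDr !(dotcC w). Qed.

Lemma dotcZl a u v : dotc (a *: u) v = a * dotc u v.
Proof. by rewrite dotcC dotcZr dotcC. Qed.

Lemma dotc0l v : dotc 0 v = 0.
Proof. by rewrite -(scale0r 0) dotcZl mul0r. Qed.

Lemma dotc_sum u v : dotc u v = \sum_i u i 0 * v i 0.
Proof. by rewrite /dotc mxE; apply: eq_bigr => i _; rewrite mxE. Qed.

Lemma dotc_ge0 u : 0 <= dotc u u.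
Proof. by rewrite dotc_sum sumr_ge0 // => i _; rewrite -expr2 sqr_ge0. Qed.

Lemma dotc_eq0 u : (dotc u u == 0) = (u == 0).
Proof.
apply/eqP/eqP => [|->]; last by rewrite dotc0l.
rewrite dotc_sum => /eqP.
rewrite psumr_eq0 => [/allP z|i _]; last by rewrite -expr2 sqr_ge0.
apply/colP => i; have := z i (mem_index_enum _).
by rewrite /= mulf_eq0 orbb mxE => /eqP.
Qed.

Lemma dotc_gt0 u : (0 < dotc u u) = (u != 0).
Proof. by rewrite lt_neqAle dotc_ge0 andbT eq_sym dotc_eq0. Qed.

Lemma sym_dotc A u v : A^T = A -> dotc u (A *m v) = dotc (A *m u) v.
Proof. by move=> sA; rewrite /dotc trmx_mul sA mulmxA. Qed.

(** The form at [u + t *: v] is a polynomial in [t] of degree at most two that is nonnegative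
    everywhere. As [A] is only semidefinite, its leading coefficient [c] may vanish. *)
Lemma cauchy_schwarz_form A u v :
  A^T = A -> (forall w, 0 <= dotc w (A *m w)) ->
  dotc u (A *m v) ^+ 2 <= dotc u (A *m u) * dotc v (A *m v).
Proof.
move=> sA pA.
set a := dotc u (A *m u); set b := dotc u (A *m v); set c := dotc v (A *m v).
have q t : 0 <= a + 2 * t * b + t ^+ 2 * c.
  have := pA (u + t *: v).
  rewrite mulmxDr -scalemxAr !dotcDr !dotcDl !dotcZr !dotcZl -/a -/c.
  rewrite (sym_dotc _ _ sA) [dotc (A *m v) u]dotcC -/b.
  by move=> h; apply: le_trans h _; rewrite le_eqVlt; apply/orP; left;
    apply/eqP; ring.
have [c0|cn0] := eqVneq c 0.
  have [->|bn0] := eqVneq b 0; first by rewrite expr0n /= c0 mulr0.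
  (* With [c = 0] the polynomial is affine; this [t] is where it takes the value -1. *)
  have := q (- (a + 1) / (2 * b)); rewrite c0.
  have -> : a + 2 * (- (a + 1) / (2 * b)) * b + (- (a + 1) / (2 * b)) ^+ 2 * 0
    = -1 by field.
  by rewrite lerNr oppr0 ler10.
have c_gt0 : 0 < c by rewrite lt_neqAle eq_sym cn0 pA.
(* The minimizer of the parabola. *)
have := q (- b / c).
have -> : a + 2 * (- b / c) * b + (- b / c) ^+ 2 * c = (a * c - b ^+ 2) / c.
  by field.
by rewrite pmulr_lge0 ?invr_gt0 // subr_ge0.
Qed.

Lemma cauchy_schwarz u v : dotc u v ^+ 2 <= dotc u u * dotc v v.
Proof.
have := @cauchy_schwarz_form 1%:M u v (trmx1 _ _).
by rewrite !mul1mx; apply=> w; rewrite mul1mx dotc_ge0.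
Qed.

(* Cauchy-Schwarz for the form [A], applied to [u] and [A u]. *)
Lemma sqr_form_le A t u :
    A^T = A -> (forall w, 0 <= dotc w (A *m w)) ->
    (forall w, dotc w (A *m w) <= t * dotc w w) ->
  dotc (A *m u) (A *m u) <= t * dotc u (A *m u).
Proof.
move=> sA pA tA; set v := A *m u.
have := cauchy_schwarz_form v u sA pA; rewrite -/v => h.
have [->|] := eqVneq (dotc v v) 0.
  have [->|u0] := eqVneq u 0; first by rewrite dotc0l mulr0.
  (* The sign of [t] follows from the two bounds on the form at the nonzero vector [u]. *)
  rewrite mulr_ge0 ?pA // -(pmulr_lge0 _ (_ : 0 < dotc u u)) ?dotc_gt0 //.
  exact: le_trans (pA u) (tA u).
rewrite dotc_eq0 -dotc_gt0 => v_gt0; rewrite -(ler_pM2l v_gt0) -expr2.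
by apply: le_trans h _; rewrite mulrA [_ * t]mulrC ler_wpM2r ?pA.
Qed.
End Dot.

(** * Rayleigh quotient bounds *)

Section Rayleigh.
Variables (R : rcfType) (n : nat).
Implicit Types (A : 'M[R]_n) (x : 'cV[R]_n).
Local Open Scope sesquilinear_scope.

(** Over the complex numbers [A] becomes Hermitian and is diagonalized by a unitary [P]. With
    [z = P x] the form equals the sum of [d i * |z i|^2] while [dotc x x] is the sum of [|z i|^2],
    so a bound on the [d i] suffices. *)
Lemma rayleigh_le A (a : R) x :
  A^T = A -> (forall e, eigenvalue A e -> e <= a) ->
  dotc x (A *m x) <= a * dotc x x.
Proof.
move=> sA hA; pose f := real_complex R.
have conj_map k l (B : 'M[R]_(k, l)) : map_mx Num.conj (map_mx f B) = map_mx f B.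
  by apply/matrixP=> i j; rewrite !mxE conj_Creal //; apply/complex_realP; eexists.
set Ac := map_mx f A; have hermA : Ac \is hermsymmx.
  by apply/is_hermitianmxP; rewrite expr0 scale1r map_trmx conj_map sA.
have /orthomx_spectralP := hermitian_normalmx hermA.
have /mxOverP := hermitian_spectral_diag_real hermA.
have uP := spectral_unitarymx Ac.
have unitP := spectral_unit Ac.
move: (spectralmx Ac) (spectral_diag Ac) uP unitP => P d uP unitP d_real AcE.
have PA : P *m Ac = diag_mx d *m P by rewrite AcE -mulmxA mulKVmx.
(* Row [i] of [P] is a left eigenvector for [d 0 i]; this value is real, hence already an eigenvalue
   of [A] over [R]. *)
have d_le i : d 0 i <= f a.
  have /complex_realP[r dr] := d_real 0 i.
  have {dr} fr : f r = d 0 i by rewrite dr.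
  rewrite -fr lecR; apply: hA.
  have <- : eigenvalue Ac (f r) = eigenvalue A r by exact: eigenvalue_map.
  rewrite fr.
  apply/eigenvalueP; exists (row i P).
    by rewrite -row_mul PA mul_diag_mx; apply/rowP=> j; rewrite !mxE.
  apply/eqP => Pi0; have := mulmxV unitP.
  move/(congr1 (row i)); rewrite row_mul Pi0 mul0mx => /matrixP/(_ 0 i)/eqP.
  by rewrite !mxE eqxx eq_sym oner_eq0.
set xc := map_mx f x; set z := P *m xc.
have zE : z^t* = xc^T *m invmx P.
  by rewrite trmx_mul map_mxM /= map_trmx conj_map invmx_unitary.
have sum_z (w : 'rV_n) : (z^t* *m (diag_mx w *m z)) 0 0
    = \sum_i w 0 i * `|z i 0| ^+ 2.
  rewrite mxE; apply: eq_bigr => i _.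
  by rewrite mul_diag_mx !mxE normCKC mulrCA.
have AE : f (dotc x (A *m x)) = \sum_i d 0 i * `|z i 0| ^+ 2.
  rewrite -sum_z zE -mulmxA [diag_mx d *m _]mulmxA -PA /z !mulmxA.
  by rewrite mulmxKV // /xc map_trmx -!map_mxM /dotc mulmxA [in RHS]mxE.
have IE : f (a * dotc x x) = \sum_i f a * `|z i 0| ^+ 2.
  have /= := sum_z (const_mx (f a)); under eq_bigr do rewrite mxE.
  move<-; rewrite diag_const_mx mul_scalar_mx -scalemxAr mxE zE /z mulmxA.
  by rewrite mulmxKV // /xc map_trmx -!map_mxM [in RHS]mxE /f rmorphM.
suff: f (dotc x (A *m x)) <= f (a * dotc x x) by rewrite lecR.
by rewrite AE IE ler_sum // => i _; rewrite ler_wpM2r ?exprn_ge0.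
Qed.

Lemma rayleigh_ge A (a : R) x :
  A^T = A -> (forall e, eigenvalue A e -> a <= e) ->
  a * dotc x x <= dotc x (A *m x).
Proof.
move=> sA hA; rewrite -lerN2.
have -> : - dotc x (A *m x) = dotc x (- A *m x).
  by rewrite mulNmx -scaleN1r dotcZr mulN1r.
rewrite -mulNr; apply: rayleigh_le => [|e]; first by rewrite linearN /= sA.
move=> /eigenvalueP[v Av v0]; rewrite lerNr; apply: hA; apply/eigenvalueP.
by exists v => //; rewrite -[A]opprK mulmxN Av scaleNr.
Qed.
End Rayleigh.

(** * Eigenvalue bounds for saddle point systems *)

Section SaddlePoint.
Variable R : rcfType.

(** Completing the square: [(2 l - e + f)^2 = (e + f)^2 + 4 (l - e) (l + f)]. *)
Lemma le_quadratic_root (l e f t : R) :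
  (l - e) * (l + f) <= t ^+ 2 ->
  l <= (e - f + Num.sqrt ((e + f) ^+ 2 + 4 * t ^+ 2)) / 2.
Proof.
move=> h; suff : 2 * l - e + f <= Num.sqrt ((e + f) ^+ 2 + 4 * t ^+ 2) by lra.
apply: le_trans (ler_norm _) _; rewrite -sqrtr_sqr ler_wsqrtr //; nra.
Qed.

Lemma ge_quadratic_root (l e f s : R) :
  0 < l -> 0 <= e -> 0 <= f -> s ^+ 2 <= (l - e) * (l + f) ->
  (e - f + Num.sqrt ((e + f) ^+ 2 + 4 * s ^+ 2)) / 2 <= l.
Proof.
move=> l0 e0 f0 h; have lf : 0 < l + f by lra.
(* This gives [2 l - e + f >= 0], which singles out the larger root. *)
have le : 0 <= l - e by rewrite -(pmulr_lge0 _ lf) (le_trans (sqr_ge0 s) h).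
suff : Num.sqrt ((e + f) ^+ 2 + 4 * s ^+ 2) <= 2 * l - e + f by lra.
rewrite -[leRHS]ger0_norm; last by lra.
rewrite -sqrtr_sqr ler_wsqrtr //; nra.
Qed.

Lemma shifted_sqr_form_le n (A : 'M[R]_n) (t l : R) (u : 'cV[R]_n) :
    A^T = A -> (forall w, 0 <= dotc w (A *m w)) ->
    (forall w, dotc w (A *m w) <= t * dotc w w) -> 0 <= l ->
  dotc (A *m u + l *: u) (A *m u + l *: u)
    <= (t + l) * dotc u (A *m u + l *: u).
Proof.
move=> sA pA tA l0.
have E w : A *m w + l *: w = (A + l%:M) *m w by rewrite mulmxDl mul_scalar_mx.
have D w : dotc w ((A + l%:M) *m w) = dotc w (A *m w) + l * dotc w w.
  by rewrite -E dotcDr dotcZr.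
rewrite E; apply: sqr_form_le => [|w|w].
- by rewrite linearD /= sA tr_scalar_mx.
- by rewrite D addr_ge0 ?pA // mulr_ge0 ?dotc_ge0.
- by rewrite D mulrDl lerD2r tA.
Qed.

(** Stated for general blocks so as to apply both to [(D, S, L)] and, for the negative eigenvalues,
    to [(S, D, - L^T)]. *)
Lemma saddle_pos_bounds m k (E : 'M[R]_m) (F : 'M[R]_k) (K : 'M[R]_(m, k))
    (x : 'cV[R]_m) (y : 'cV[R]_k) (l emin emax fmin fmax s t : R) :
    F^T = F ->
    (forall u, emin * dotc u u <= dotc u (E *m u) <= emax * dotc u u) ->
    (forall u, fmin * dotc u u <= dotc u (F *m u) <= fmax * dotc u u) ->
    (forall u, s ^+ 2 * dotc u u <= dotc (K^T *m u) (K^T *m u)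
                 <= t ^+ 2 * dotc u u) ->
    0 <= emin -> 0 <= fmin -> fmin <= fmax -> 0 < l ->
    (x != 0) || (y != 0) ->
    E *m x + K *m y = l *: x -> K^T *m x - F *m y = l *: y ->
  (emin - fmax + Num.sqrt ((emin + fmax) ^+ 2 + 4 * s ^+ 2)) / 2 <= l
  <= (emax - fmin + Num.sqrt ((emax + fmin) ^+ 2 + 4 * t ^+ 2)) / 2.
Proof.
move=> sF hE hF hK e0 f0 ff l0 xy0 eqx eqy.
have F_ge0 u : 0 <= dotc u (F *m u).
  by case/andP: (hF u) => + _; apply: le_trans; rewrite mulr_ge0 ?dotc_ge0.
have F_le u : dotc u (F *m u) <= fmax * dotc u u by case/andP: (hF u).
have eqy' : K^T *m x = F *m y + l *: y by rewrite -eqy addrC subrK.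
(* If [x = 0], pairing the second equation with [y] gives [y^T F y + l |y|^2 = 0], so [y = 0]
   too. *)
have x0 : x != 0.
  apply: contraTneq xy0 => x0; rewrite x0 eqxx /= negbK -dotc_eq0.
  have := congr1 (dotc y) eqy'; rewrite x0 mulmx0 dotcC dotc0l dotcDr dotcZr.
  have := F_ge0 y; have := dotc_ge0 y; nra.
have a_gt0 : 0 < dotc x x by rewrite dotc_gt0.
have c1 : dotc x (E *m x) + dotc x (K *m y) = l * dotc x x.
  by rewrite -dotcDr eqx dotcZr.
have cE : dotc x (K *m y) = dotc (K^T *m x) y.
  by rewrite /dotc trmx_mul trmxK mulmxA.
have c2 : dotc x (K *m y) = dotc y (F *m y) + l * dotc y y.
  by rewrite cE eqy' dotcC dotcDr dotcZr.
have c_ge0 : 0 <= dotc x (K *m y).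
  by rewrite c2 addr_ge0 // mulr_ge0 ?dotc_ge0 // ltW.
have /andP[kx1 kx2] := hK x; have /andP[ex1 ex2] := hE x.
have /andP[fy1 fy2] := hF y.
apply/andP; split.
(* [s^2 |x|^2 <= |K^T x|^2 <= (fmax + l) x^T K y <= (fmax + l) (l - emin) |x|^2]. *)
- apply: ge_quadratic_root => //; first exact: le_trans ff.
  have := shifted_sqr_form_le y sF F_ge0 F_le (ltW l0).
  rewrite -eqy' [dotc y _]dotcC -cE => h.
  rewrite -(ler_pM2r a_gt0); apply: le_trans kx1 _; apply: le_trans h _.
  have : 0 <= fmax + l by lra.
  nra.
- apply: le_quadratic_root; rewrite -(ler_pM2r a_gt0).
  apply: le_trans kx2.
  have := cauchy_schwarz (K^T *m x) y; rewrite -cE.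
  have b_ge0 := dotc_ge0 y; have k_ge0 := dotc_ge0 (K^T *m x).
  move: (dotc (K^T *m x) _) (dotc x (K *m y)) (dotc y y) c1 c2 c_ge0 b_ge0
    k_ge0 fy1 => kk c b c1 c2 c_ge0 b_ge0 k_ge0 fy1 cs.
  have h1 : (l + fmin) * b <= c by lra.
  (* Cauchy-Schwarz gives [c^2 <= kk * b]; multiply by [l + fmin], use [h1], and cancel one factor
     [c]. *)
  have h2 : c * (l + fmin) <= kk.
    have [->|c0] := eqVneq c 0; first by rewrite mul0r.
    have c_gt0 : 0 < c by rewrite lt_neqAle eq_sym c0.
    rewrite -(ler_pM2l c_gt0) mulrA -expr2.
    have lf : 0 <= l + fmin by lra.
    apply: (le_trans (ler_wpM2r lf cs)); rewrite -mulrA mulrC ler_wpM2r //.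
    by rewrite mulrC.
  apply: le_trans h2; rewrite mulrAC ler_wpM2r //; lra.
Qed.

(** Here [mu] stands for [- lambda]. The two alternatives become [lambda <= beta2] and
    [lambda <= beta3], whence the maximum in the theorem. *)
Lemma saddle_neg_bound m k (D L : 'M[R]_m) (C : 'M[R]_k) (H : 'M[R]_(k, m))
    (x y : 'cV[R]_m) (mu psi rho theta : R) :
    D^T = D -> (forall u, 0 <= dotc u (D *m u) <= psi * dotc u u) ->
    C^T = C -> C \in unitmx ->
    (forall u, 0 <= dotc u (C *m u) <= rho * dotc u u) ->
    (forall u, theta ^+ 2 * dotc u u
       <= dotc (L *m u) (L *m u) + dotc (H *m u) (H *m u)) ->
    0 < mu -> (x != 0) || (y != 0) ->
    D *m x + L *m y = - mu *: x ->
    L^T *m x - H^T *m invmx C *m H *m y = - mu *: y ->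
  (theta ^+ 2 <= mu * rho) || (theta ^+ 2 <= mu * (mu + psi)).
Proof.
move=> sD hD sC uC hC hT mu0 xy0 eqx eqy.
have D_ge0 u : 0 <= dotc u (D *m u) by case/andP: (hD u).
have D_le u : dotc u (D *m u) <= psi * dotc u u by case/andP: (hD u).
have C_ge0 u : 0 <= dotc u (C *m u) by case/andP: (hC u).
have C_le u : dotc u (C *m u) <= rho * dotc u u by case/andP: (hC u).
have eqx' : D *m x + mu *: x = - (L *m y).
  by rewrite -[mu]opprK scaleNr -eqx opprD addNKr.
have y0 : y != 0.
  apply: contraTneq xy0 => y0; rewrite y0 eqxx orbF negbK -dotc_eq0.
  have := congr1 (dotc x) eqx'; rewrite y0 mulmx0 oppr0 [RHS]dotcC dotc0l.
  rewrite dotcDr dotcZr.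
  have := D_ge0 x; have := dotc_ge0 x; nra.
have b_gt0 : 0 < dotc y y by rewrite dotc_gt0.
(* With this [w], [y^T S y = w^T C w] and [|H y|^2 = |C w|^2], so the upper bound on [C] itself
   replaces a lower bound on its inverse. *)
set w := invmx C *m (H *m y).
have HE : H *m y = C *m w by rewrite /w mulKVmx.
have Sy : dotc y (H^T *m invmx C *m H *m y) = dotc w (C *m w).
  by rewrite -!mulmxA -/w dotcC -HE /dotc !trmx_mul trmxK mulmxA.
have cE : dotc y (L^T *m x) = dotc x (L *m y).
  by rewrite dotcC /dotc trmx_mul trmxK mulmxA.
have eqb := congr1 (dotc y) eqy; rewrite dotcBr Sy cE dotcZr in eqb.
have hL := shifted_sqr_form_le x sD D_ge0 D_le (ltW mu0).
have c_le0 : 0 <= dotc x (D *m x + mu *: x).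
  by rewrite dotcDr dotcZr addr_ge0 // mulr_ge0 ?dotc_ge0 // ltW.
have NE : dotc x (- (L *m y)) = - dotc x (L *m y).
  by rewrite -scaleN1r dotcZr mulN1r.
rewrite eqx' NE -!scaleN1r dotcZl dotcZr mulrA mulrNN !mul1r in hL.
rewrite eqx' NE in c_le0.
have := hT y; rewrite HE; have := sqr_form_le w sC C_ge0 C_le.
have := C_ge0 w; have b_ge0 := ltW b_gt0.
move: (dotc w (C *m w)) (dotc (C *m w) _) (dotc (L *m y) _) (dotc x (L *m y))
  (dotc y y) eqb hL c_le0 b_gt0 b_ge0
  => g h q c b eqb hL c_le0 b_gt0 b_ge0 g_ge0 hg hT'.
(* Now [mu b = g - c] with [g] and [- c] nonnegative, and [theta^2 b <= (psi + mu) (- c) + rho g];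
   the larger of the two coefficients bounds the right side by a multiple of [mu b]. *)
have [le_rho|/ltW le_rho] := leP rho (mu + psi); apply/orP; [right|left];
  rewrite -(ler_pM2r b_gt0); nra.
Qed.

End SaddlePoint.

(** * Symmetric matrices and Gram matrices *)

Section SymmetricMatrices.
Variable R : rcfType.

(** Eigenvectors in [eigenvalue] are rows; symmetry allows transposing them. *)
Lemma eigenvalue_sym n (A : 'M[R]_n) e :
  A^T = A -> eigenvalue A e -> exists2 x : 'cV_n, x != 0 & A *m x = e *: x.
Proof.
move=> sA /eigenvalueP[v Av v0]; exists v^T; first by rewrite trmx_eq0.
by rewrite -{1}sA -trmx_mul Av linearZ.
Qed.

Lemma eigenvalue_ge0 n (A : 'M[R]_n) e :
  A^T = A -> (forall u, 0 <= dotc u (A *m u)) -> eigenvalue A e -> 0 <= e.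
Proof.
move=> sA pA /(eigenvalue_sym sA)[x x0 Ax].
by have := pA x; rewrite Ax dotcZr pmulr_lge0 // dotc_gt0.
Qed.

Lemma dotc_mulmx_tr m n (A : 'M[R]_(m, n)) (x : 'cV_m) :
  dotc x (A *m A^T *m x) = dotc (A^T *m x) (A^T *m x).
Proof. by rewrite /dotc trmx_mul trmxK !mulmxA. Qed.

Lemma sym_mulmx_tr m n (A : 'M[R]_(m, n)) : (A *m A^T)^T = A *m A^T.
Proof. by rewrite trmx_mul trmxK. Qed.

(** Every eigenvalue of [A *m A^T] is nonnegative, hence the square of some [r >= 0], to which the
    hypothesis applies. *)
Lemma gram_ge m n (A : 'M[R]_(m, n)) (s : R) (x : 'cV_m) :
    0 <= s -> (forall r, 0 <= r -> eigenvalue (A *m A^T) (r ^+ 2) -> s <= r) ->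
  s ^+ 2 * dotc x x <= dotc (A^T *m x) (A^T *m x).
Proof.
move=> s0 hs; rewrite -dotc_mulmx_tr; apply: rayleigh_ge => [|e ev].
  exact: sym_mulmx_tr.
have e0 : 0 <= e.
  apply: eigenvalue_ge0 ev => [|u]; first exact: sym_mulmx_tr.
  by rewrite dotc_mulmx_tr dotc_ge0.
rewrite -(sqr_sqrtr e0) ler_sqr ?nnegrE ?sqrtr_ge0 //.
by apply: hs; rewrite ?sqrtr_ge0 ?sqr_sqrtr.
Qed.

Lemma gram_le m n (A : 'M[R]_(m, n)) (s : R) (x : 'cV_m) :
    0 <= s -> (forall r, 0 <= r -> eigenvalue (A *m A^T) (r ^+ 2) -> r <= s) ->
  dotc (A^T *m x) (A^T *m x) <= s ^+ 2 * dotc x x.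
Proof.
move=> s0 hs; rewrite -dotc_mulmx_tr; apply: rayleigh_le => [|e ev].
  exact: sym_mulmx_tr.
have e0 : 0 <= e.
  apply: eigenvalue_ge0 ev => [|u]; first exact: sym_mulmx_tr.
  by rewrite dotc_mulmx_tr dotc_ge0.
rewrite -(sqr_sqrtr e0) ler_sqr ?nnegrE ?sqrtr_ge0 //.
by apply: hs; rewrite ?sqrtr_ge0 ?sqr_sqrtr.
Qed.

(** Transfers the singular value bounds from [L^T] to [L]: [v *m A^T] is the new eigenvector,
    nonzero by invertibility. *)
Lemma eigenvalue_mulmx_trC n (A : 'M[R]_n) e :
  A \in unitmx -> eigenvalue (A^T *m A) e -> eigenvalue (A *m A^T) e.
Proof.
move=> uA /eigenvalueP[v Av v0]; apply/eigenvalueP; exists (v *m A^T).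
  by rewrite -!mulmxA [A^T *m (A *m _)]mulmxA mulmxA Av -scalemxAl.
have uAT : A^T \in unitmx by rewrite unitmx_tr.
by apply: contra v0 => /eqP vA0; rewrite -(mulmxK uAT v) vA0 mul0mx.
Qed.
End SymmetricMatrices.

(** * Positive definite and block bidiagonal matrices *)

Section Blocks.
Variable R : realType.

Lemma sym_posdef_ge0 n (A : 'M[R]_n) (x : 'cV_n) :
  sym_posdef A -> 0 <= dotc x (A *m x).
Proof.
move=> [_ pA]; have [->|/pA] := eqVneq x 0; first by rewrite dotc0l.
by rewrite /dotc mulmxA => /ltW.
Qed.

Lemma sym_posdef_unitmx n (A : 'M[R]_n) : sym_posdef A -> A \in unitmx.
Proof.
move=> [_ pA]; rewrite unitmxE unitfE; apply/negP => /det0P[v v0 vA].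
by have := pA v^T; rewrite trmx_eq0 trmxK vA mul0mx mxE ltxx => /(_ v0).
Qed.

Lemma sym_posdef_eigenvalue_gt0 n (A : 'M[R]_n) e :
  sym_posdef A -> eigenvalue A e -> 0 < e.
Proof.
move=> [sA pA] /(eigenvalue_sym sA)[x x0 Ax].
have := pA x x0; rewrite -mulmxA -/(dotc _ _) Ax dotcZr pmulr_lgt0 //.
by rewrite dotc_gt0.
Qed.

Lemma sym_posdef_mxdiag N (p : 'I_N -> nat) (A : forall i, 'M[R]_(p i)) :
  (forall i, sym_posdef (A i)) -> sym_posdef (\mxdiag_i A i).
Proof.
move=> hA; split=> [|x x0].
  by rewrite tr_mxdiag; apply: eq_mxdiag => i; case: (hA i).
rewrite -mulmxA -[x](submxcolK x) mul_mxdiag_mxcol tr_mxcol mul_mxrow_mxcol.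
rewrite summxE.
have pos i : 0 <= ((submxcol x i)^T *m (A i *m submxcol x i)) 0 0.
  exact: sym_posdef_ge0.
rewrite lt_neqAle sumr_ge0 // andbT; apply: contra x0 => /eqP/esym/eqP.
rewrite psumr_eq0 // => /allP z; rewrite -[x](submxcolK x).
suff -> : \mxcol_i submxcol x i = \mxcol_i (0 : 'M[R]_(p i, 1)) by rewrite mxcol0.
apply/eq_mxcol => i; have /eqP := z i (mem_index_enum _).
case: (eqVneq (submxcol x i) 0) => // xi0; case: (hA i) => _ /(_ _ xi0).
by rewrite mulmxA => /gt_eqF/eqP.
Qed.

Lemma blockL_unitmx N n (M : 'I_N -> 'M[R]_n) : blockL M \in unitmx.
Proof.
rewrite unitmxE; suff -> : \det (blockL M) = 1 by exact: unitr1.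
rewrite det_trig; first by rewrite big1 // => s _; rewrite !mxE !eqxx mxE eqxx.
apply/is_trig_mxblockP; split=> [i j lt_ij|i].
  rewrite ifF; last by apply: contraTF lt_ij => /eqP->; rewrite ltnn.
  (* [lift ord0 k] has value [k + 1], so [k = j] would put [i] below the diagonal. *)
  case: unliftP => // k ik; rewrite ifF //; apply: contraTF lt_ij => /eqP kj.
  by rewrite ik -kj -leqNgt leq_addl.
by rewrite eqxx scalar_mx_is_trig.
Qed.
End Blocks.

(** * Assembly of the bounds for the block system *)

Theorem theorem6 (R : realType) (N n : nat) (p : 'I_N.+1 -> nat)
  (hN : (1 <= N)%N) (hn : (1 <= n)%N) (hp : (1 <= \sum_(i < N.+1) p i)%N)
  (B : 'M[R]_n) (Q : 'I_N -> 'M[R]_n)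
  (R_ : forall i : 'I_N.+1, 'M[R]_(p i))
  (M : 'I_N -> 'M[R]_n) (H_ : forall i : 'I_N.+1, 'M[R]_(p i, n))
  (hB : sym_posdef B) (hQ : forall k : 'I_N, sym_posdef (Q k))
  (hR : forall i : 'I_N.+1, sym_posdef (R_ i))
  (psi_min psi_max nu_min nu_max rho_max sigma_min sigma_max theta_min : R) :
  let bD := blockD B Q in
  let bR := blockR R_ in
  let bH := blockH H_ in
  let bL := blockL M in
  let A2 := saddle2 bD bL bR bH in
  is_smallest (eigenvalue bD) psi_min ->
  is_largest (eigenvalue bD) psi_max ->
  is_smallest (eigenvalue (bH^T *m invmx bR *m bH)) nu_min ->
  is_largest (eigenvalue (bH^T *m invmx bR *m bH)) nu_max ->
  is_largest (eigenvalue bR) rho_max ->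
  is_smallest (singular_value bL) sigma_min ->
  is_largest (singular_value bL) sigma_max ->
  is_smallest (fun s : R => singular_value (row_mx bL^T bH^T) s && (s != 0))
    theta_min ->
  let beta1 := (psi_max - nu_min
     - Num.sqrt ((psi_max + nu_min) ^+ 2 + 4 * sigma_min ^+ 2)) / 2 in
  let beta2 := - (rho_max^-1 * theta_min ^+ 2) in
  let beta3 := (psi_max - Num.sqrt (psi_max ^+ 2 + 4 * theta_min ^+ 2)) / 2 in
  (forall lambda : R, eigenvalue A2 lambda -> lambda < 0 ->
     lambda \in `[ (psi_min - nu_max
          - Num.sqrt ((psi_min + nu_max) ^+ 2 + 4 * sigma_max ^+ 2)) / 2,
        Num.min beta1 (Num.max beta2 beta3) ]) /\
  (forall lambda : R, eigenvalue A2 lambda -> 0 < lambda ->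
     lambda \in `[ (psi_min - nu_max
          + Num.sqrt ((psi_min + nu_max) ^+ 2 + 4 * sigma_min ^+ 2)) / 2,
        (psi_max - nu_min
          + Num.sqrt ((psi_max + nu_min) ^+ 2 + 4 * sigma_max ^+ 2)) / 2 ]).
Proof.
move=> bD bR bH bL A2 [psi_min_ev psi_min_le] [psi_max_ev psi_max_ge]
  [nu_min_ev nu_min_le] [nu_max_ev nu_max_ge] [rho_max_ev rho_max_ge]
  [sigma_min_ev sigma_min_le] [sigma_max_ev sigma_max_ge]
  [theta_min_ev theta_min_le] beta1 beta2 beta3.
have pdD : sym_posdef bD by apply: sym_posdef_mxdiag => i; case: unlift.
have pdR : sym_posdef bR by apply: sym_posdef_mxdiag.
have uL : bL \in unitmx by exact: blockL_unitmx.
(* The block structure enters through the three facts just proved. *)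
clearbody bD bR bH bL; clear B Q R_ M H_ hB hQ hR.
have [sD _] := pdD; have [sR _] := pdR; have uR := sym_posdef_unitmx pdR.
set S := bH^T *m invmx bR *m bH in nu_min_ev nu_min_le nu_max_ev nu_max_ge.
have sS : S^T = S by rewrite /S !trmx_mul trmxK trmx_inv sR mulmxA.
have sA2 : A2^T = A2.
  by rewrite /A2 /saddle2 tr_block_mx sD trmxK -/S linearN /= sS.
have S_ge0 u : 0 <= dotc u (S *m u).
  have -> : dotc u (S *m u)
    = dotc (invmx bR *m (bH *m u)) (bR *m (invmx bR *m (bH *m u))).
    by rewrite mulKVmx // dotcC /S /dotc !trmx_mul trmxK !mulmxA.
  exact: sym_posdef_ge0.
have D_bounds u : psi_min * dotc u u <= dotc u (bD *m u) <= psi_max * dotc u u.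
  by rewrite rayleigh_ge ?rayleigh_le.
have S_bounds u : nu_min * dotc u u <= dotc u (S *m u) <= nu_max * dotc u u.
  by rewrite rayleigh_ge ?rayleigh_le.
have R_bounds u : 0 <= dotc u (bR *m u) <= rho_max * dotc u u.
  by rewrite sym_posdef_ge0 ?rayleigh_le.
have psi_min_ge0 : 0 <= psi_min by rewrite ltW // (sym_posdef_eigenvalue_gt0 pdD).
have psi_le : psi_min <= psi_max by exact: psi_min_le.
have nu_min_ge0 : 0 <= nu_min by exact: eigenvalue_ge0 nu_min_ev.
have nu_le : nu_min <= nu_max by exact: nu_min_le.
have rho_gt0 : 0 < rho_max by rewrite (sym_posdef_eigenvalue_gt0 pdR).
have sigmaE s : singular_value bL s =
    (0 <= s) && eigenvalue (bL *m bL^T) (s ^+ 2).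
  by rewrite /singular_value leqnn.
have smin_ge0 : 0 <= sigma_min by move: sigma_min_ev; rewrite sigmaE => /andP[].
have smax_ge0 : 0 <= sigma_max by move: sigma_max_ev; rewrite sigmaE => /andP[].
have LT_bounds u : sigma_min ^+ 2 * dotc u u <= dotc (bL^T *m u) (bL^T *m u)
    <= sigma_max ^+ 2 * dotc u u.
  apply/andP; split; [apply: gram_ge|apply: gram_le] => // r r0 ev;
    [apply: sigma_min_le|apply: sigma_max_ge]; by rewrite sigmaE r0.
have L_bounds u : sigma_min ^+ 2 * dotc u u <= dotc (bL *m u) (bL *m u)
    <= sigma_max ^+ 2 * dotc u u.
  rewrite -[bL in X in _ <= X <= _]trmxK.
  apply/andP; split; [apply: gram_ge|apply: gram_le] => // r r0;
    rewrite trmxK => /(eigenvalue_mulmx_trC uL) ev;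
    [apply: sigma_min_le|apply: sigma_max_ge]; by rewrite sigmaE r0.
set G := row_mx bL^T bH^T.
have GE u : dotc (G^T *m u) (G^T *m u)
    = dotc (bL *m u) (bL *m u) + dotc (bH *m u) (bH *m u).
  rewrite /G tr_row_mx !trmxK mul_col_mx /dotc tr_col_mx mul_row_col.
  by rewrite mxE.
have theta_bound u : theta_min ^+ 2 * dotc u u
    <= dotc (bL *m u) (bL *m u) + dotc (bH *m u) (bH *m u).
  rewrite -GE; apply: gram_ge => [|r r0 ev].
    by case/andP: theta_min_ev => /andP[].
  apply: theta_min_le; rewrite /singular_value leq_addr r0 ev /=.
  (* The value 0 is excluded: [G *m G^T *m v = 0] forces [|L v|^2 + |H v|^2 = 0], and [L] is
     invertible. *)
  apply: contraTneq ev => ->; rewrite expr0n /=.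
  apply/negP => /(eigenvalue_sym (sym_mulmx_tr _))[v v0 Gv].
  have := dotc_mulmx_tr G v; rewrite Gv scale0r dotcC dotc0l GE => /eqP.
  rewrite eq_sym paddr_eq0 ?dotc_ge0 // !dotc_eq0 => /andP[/eqP Lv _].
  by move: v0; rewrite -[v](mulKmx uL) Lv mulmx0 eqxx.
have split_ev l : eigenvalue A2 l -> exists x y : 'cV_(\sum_(i < N.+1) n),
    [/\ (x != 0) || (y != 0), bD *m x + bL *m y = l *: x
      & bL^T *m x - S *m y = l *: y].
  move=> /(eigenvalue_sym sA2)[z z0]; rewrite -[z]vsubmxK in z0 *.
  move: (usubmx z) (dsubmx z) z0 => x y xy0.
  rewrite /A2 /saddle2 mul_block_col mulNmx scale_col_mx.
  move=> /eq_col_mx[eqx eqy]; exists x, y; split => //.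
  apply: contraR xy0; rewrite negb_or !negbK => /andP[/eqP-> /eqP->].
  by rewrite col_mx0.
split=> l /split_ev[x [y [xy0 eqx eqy]]] l0; last first.
  by rewrite in_itv /= (saddle_pos_bounds sS D_bounds S_bounds LT_bounds
    _ _ _ _ xy0 eqx eqy).
have nl0 : 0 < - l by rewrite oppr_gt0.
have NLT_bounds u : sigma_min ^+ 2 * dotc u u
    <= dotc ((- bL^T)^T *m u) ((- bL^T)^T *m u)
    <= sigma_max ^+ 2 * dotc u u.
  by rewrite linearN /= trmxK mulNmx -scaleN1r dotcZl dotcZr mulrA mulrNN !mul1r.
(* [- A2] is, up to exchanging the two blocks, again of saddle point form. *)
have eqy' : S *m y + (- bL^T) *m x = - l *: y.
  by rewrite scaleNr -eqy mulNmx opprB.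
have eqx' : (- bL^T)^T *m y - bD *m x = - l *: x.
  by rewrite linearN /= trmxK mulNmx scaleNr -eqx opprD addrC.
have yx0 : (y != 0) || (x != 0) by rewrite orbC.
have /andP[lower upper] := saddle_pos_bounds sD S_bounds D_bounds NLT_bounds
  nu_min_ge0 psi_min_ge0 psi_le nl0 yx0 eqy' eqx'.
(* Negation swaps the ends: [upper] for [- l] is the left end for [l], and [lower] gives [beta1]. *)
rewrite in_itv /= le_min le_max; apply/and3P; split.
- by move: upper; rewrite (addrC psi_min nu_max); lra.
- by move: lower; rewrite /beta1 (addrC psi_max nu_min); lra.
have D_bounds0 u : 0 <= dotc u (bD *m u) <= psi_max * dotc u u.
  by rewrite sym_posdef_ge0 //; case/andP: (D_bounds u).
rewrite -[l]opprK in eqx eqy.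
have /orP[h|h] := saddle_neg_bound sD D_bounds0 sR uR R_bounds theta_bound nl0
  xy0 eqx eqy; apply/orP; [left|right].
  by rewrite /beta2 lerNr mulrC ler_pdivrMr.
(* [beta3] is minus the larger root for [e = 0] and [f = psi_max]. *)
have := @ge_quadratic_root _ (- l) 0 psi_max theta_min nl0 (lexx _) _ _.
rewrite /beta3 !add0r subr0 => /(_ (le_trans psi_min_ge0 psi_le) h).
lra.
Qed.
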